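(* Let $A$ be a $\star$-Green $\mathcal{D}$-biset functor over $k$ and $G\in Ob(\mathcal{D})$. The map $\widetilde{\_}:A(G)\longrightarrow End_{\mathcal{P}_A}(G)$, $a\mapsto\widetilde{a}=A(Ind(\Delta))(a)$, can be restricted to a group monomorphism $A(G)^{\times,\perp}\longrightarrow Aut_{\mathcal{P}_A}(G)^{\perp}$. Moreover, if $u\in A(G)^{\times}$ is such that $\widetilde{u}\in Aut_{\mathcal{P}_A}(G)^{\perp}$, then $u\in A(G)^{\times,\perp}$.
   Context: All groups are finite; rings and algebras are associative and unital, with unit-preserving homomorphisms. Let $k$ be a commutative ring. $B(H,G)$ is the Burnside (Grothendieck) group of finite $(H,G)$-bisets (with $[X\sqcup Y]=[X]+[Y]$), and $B_k(H,G)=k\otimes B(H,G)$. The composition of a $(K,H)$-biset $Y$ and an $(H,G)$-biset $X$ is $Y\circ X=Y\times_H X$, the quotient of $Y\times X$ by $(yh,x)\sim(y,hx)$. The biset category $\mathcal{C}$ has all finite groups as objects, $Hom_{\mathcal{C}}(G,H)=B(H,G)$, composition $\circ$, and identity of $G$ the regular $(G,G)$-biset $G$. $\mathcal{D}\subseteq\mathcal{C}$ is a full subcategory whose objects are closed under subquotients and direct products; $k\mathcal{D}$ is its $k$-linearization. A $\mathcal{D}$-biset functor over $k$ is a $k$-linear functor $k\mathcal{D}\to {}_kMod$; morphisms are natural transformations. For a homomorphism $\phi:G\to H$: $Ind(\phi)$ is $H$ as an $(H,G)$-biset ($h'\cdot h\cdot g=h'h\phi(g)$), $Res(\phi)$ is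 $H$ as a $(G,H)$-biset ($g\cdot h\cdot h'=\phi(g)hh'$), and $Iso(\phi)=Ind(\phi)$ if $\phi$ is an isomorphism. $Inf_G^{G\times H}$ is $Res$ of the projection $G\times H\to G$. $\tau_{G,H}:G\times H\to H\times G$ is $(g,h)\mapsto(h,g)$, and $\Delta:G\to G\times G$ is $g\mapsto (g,g)$. A Green $\mathcal{D}$-biset functor over $k$ is a $\mathcal{D}$-biset functor $A$ such that each $A(G)$ is a $k$-algebra and, for each homomorphism $\phi:G\to H$ of groups in $Ob(\mathcal{D})$: $A(Res(\phi))$ is a $k$-algebra homomorphism, and $a\,A(Ind(\phi))(b)=A(Ind(\phi))(A(Res(\phi))(a)b)$, $A(Ind(\phi))(b)\,a=A(Ind(\phi))(b\,A(Res(\phi))(a))$ for $a\in A(H)$, $b\in A(G)$. For $a\in A(G)$, $b\in A(H)$ put $a\times b=A(Inf_G^{G\times H})(a)\,A(Inf_H^{G\times H})(b)\in A(G\times H)$, and let $\epsilon_A=1\in A(1)$. The associated category $\mathcal{P}_A$ has objects $Ob(\mathcal{D})$, $Hom_{\mathcal{P}_A}(G,H)=A(H\times G)$, composition $\alpha\circ\beta=A(K\times\overleftarrow{H}\times G)(\alpha\times\beta)$ for $\alpha\in A(K\times H)$, $\beta\in A(H\times G)$, and identity $A(\overrightarrow{G})(\epsilon_A)$ of $G$. Here $\overrightarrow{G}$ is $G$ as a $(G\times G,1)$-biset via $(g_1,g_2)\cdot g=g_1gg_2^{-1}$, and $K\times\overleftarrow{H}\times G$ is the $(K\times G,K\times H\times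 H\times G)$-biset $K\times H\times G$ with $(k',g')\cdot(k,h,g)\cdot(k_1,h_1,h_2,g_1)=(k'kk_1,h_1^{-1}hh_2,g'gg_1)$. A $\star$-Green $\mathcal{D}$-biset functor is a Green $\mathcal{D}$-biset functor $A$ with a chosen anti-involution, i.e. an endomorphism $\_^{\star}:A\to A$ of biset functors with $a^{\star\star}=a$ and $(ab)^{\star}=b^{\star}a^{\star}$ for all $a,b\in A(G)$, $G\in Ob(\mathcal{D})$. Its duality is the contravariant $k$-linear functor $\_^{\bullet}$ on $\mathcal{P}_A$, identity on objects, given by $\alpha^{\bullet}=A(Iso(\tau_{H,G}))(\alpha^{\star})\in A(G\times H)$ for $\alpha\in A(H\times G)$. A unit $u\in A(G)^{\times}$ is orthogonal if $u^{\star}=u^{-1}$; $A(G)^{\times,\perp}$ is the group of orthogonal units. An isomorphism $\omega$ in $\mathcal{P}_A$ is orthogonal if $\omega^{\bullet}=\omega^{-1}$; $Aut_{\mathcal{P}_A}(G)^{\perp}$ is the group of orthogonal automorphisms of $G$ in $\mathcal{P}_A$. *)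

(* Defs.v *)
From HB Require Import structures.
From mathcomp Require Import all_boot all_order all_algebra all_fingroup.
From mathcomp Require Import boolp.

Set Implicit Arguments.
Unset Strict Implicit.
Unset Printing Implicit Defensive.

Import GRing.Theory.
Local Open Scope ring_scope.
Local Open Scope quotient_scope.

(* fingroup also defines a [repr]. *)
Local Notation repr := generic_quotient.repr.

Record biset (H G : finGroupType) := Biset {
  bcar :> finType;
  lact : H -> bcar -> bcar;
  ract : bcar -> G -> bcar;
  lact1 : forall x, lact 1%g x = x;
  lactM : forall h h' x, lact (h * h')%g x = lact h (lact h' x);
  ract1 : forall x, ract x 1%g = x;
  ractM : forall x g g', ract x (g * g')%g = ract (ract x g) g';
  lractA : forall h x g, ract (lact h x) g = lact h (ract x g) }.

Arguments lact {H G} b h x.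
Arguments ract {H G} b x g.

Definition biset_iso (H G : finGroupType) (X Y : biset H G) : Prop :=
  exists f : X -> Y,
    [/\ bijective f,
        forall h x, f (lact X h x) = lact Y h (f x)
      & forall x g, f (ract X x g) = ract Y (f x) g].

Section BisetIsoEquiv.
Variables H G : finGroupType.
Implicit Types X Y Z : biset H G.

Lemma biset_iso_refl X : biset_iso X X.
Proof. by exists id; split=> //; exists id. Qed.

Lemma biset_iso_sym X Y : biset_iso X Y -> biset_iso Y X.
Proof.
case=> f [[g fK gK] fl fr]; exists g; split; first by exists f.
- by move=> h y; apply: (can_inj fK); rewrite gK fl gK.
- by move=> y h; apply: (can_inj fK); rewrite gK fr gK.
Qed.

Lemma biset_iso_trans X Y Z : biset_iso X Y -> biset_iso Y Z -> biset_iso X Z.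
Proof.
case=> f [fB fl fr] [g [gB gl gr]]; exists (g \o f); split=> /=.
- exact: bij_comp.
- by move=> h x; rewrite fl gl.
- by move=> x h; rewrite fr gr.
Qed.

End BisetIsoEquiv.

Section DisjointUnion.
Variables (H G : finGroupType) (X Y : biset H G).

Definition bsum_l (h : H) (z : X + Y) : X + Y :=
  match z with inl x => inl (lact X h x) | inr y => inr (lact Y h y) end.

Definition bsum_r (z : X + Y) (g : G) : X + Y :=
  match z with inl x => inl (ract X x g) | inr y => inr (ract Y y g) end.

Fact bsum_l1 z : bsum_l 1%g z = z.
Proof. by case: z => z /=; rewrite lact1. Qed.
Fact bsum_lM h h' z : bsum_l (h * h')%g z = bsum_l h (bsum_l h' z).
Proof. by case: z => z /=; rewrite lactM. Qed.
Fact bsum_r1 z : bsum_r z 1%g = z.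
Proof. by case: z => z /=; rewrite ract1. Qed.
Fact bsum_rM z g g' : bsum_r z (g * g')%g = bsum_r (bsum_r z g) g'.
Proof. by case: z => z /=; rewrite ractM. Qed.
Fact bsum_lrA h z g : bsum_r (bsum_l h z) g = bsum_l h (bsum_r z g).
Proof. by case: z => z /=; rewrite lractA. Qed.

Definition bsum : biset H G :=
  @Biset H G (X + Y)%type bsum_l bsum_r
    bsum_l1 bsum_lM bsum_r1 bsum_rM bsum_lrA.

End DisjointUnion.

Section Composition.
Variables (K H G : finGroupType) (Y : biset K H) (X : biset H G).

(* The pairs (y h, x) and (y, h x); this relation is already an equivalence. *)
Definition tens_rel (p q : Y * X) : bool :=
  [exists h : H, (p.1 == ract Y q.1 h) && (q.2 == lact X h p.2)].

Lemma tens_relP p q :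
  reflect (exists h, p.1 = ract Y q.1 h /\ q.2 = lact X h p.2) (tens_rel p q).
Proof.
by apply: (iffP existsP) => -[h]; [case/andP=> /eqP ? /eqP ?|case=> -> ->];
  exists h; rewrite ?eqxx.
Qed.

Fact tens_rel_refl : reflexive tens_rel.
Proof. by move=> p; apply/tens_relP; exists 1%g; rewrite ract1 lact1. Qed.

Fact tens_rel_symm p q : tens_rel p q -> tens_rel q p.
Proof.
case/tens_relP=> h [e1 e2]; apply/tens_relP; exists (h^-1)%g.
by rewrite e1 e2 -ractM -lactM mulgV mulVg ract1 lact1.
Qed.

Fact tens_rel_sym : symmetric tens_rel.
Proof. by move=> p q; apply/idP/idP; apply: tens_rel_symm. Qed.

Fact tens_rel_trans : transitive tens_rel.
Proof.
move=> q p r /tens_relP [h [e1 e2]] /tens_relP [h' [e3 e4]].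
by apply/tens_relP; exists (h' * h)%g; rewrite e1 e3 e4 e2 ractM lactM.
Qed.

Canonical tens_equiv := EquivRel tens_rel tens_rel_refl tens_rel_sym tens_rel_trans.

Definition tens := {eq_quot tens_equiv}.
HB.instance Definition _ := EqQuotient.on tens.

Definition tcl (y : Y) (x : X) : tens := \pi_tens (y, x).

Lemma tcl_eqP y x y' x' :
  reflect (exists h, y = ract Y y' h /\ x' = lact X h x) (tcl y x == tcl y' x').
Proof.
rewrite /tcl eqmodE; exact: (tens_relP (y, x) (y', x')).
Qed.

Lemma tcl_ract y h x : tcl (ract Y y h) x = tcl y (lact X h x).
Proof. by apply/eqP/tcl_eqP; exists h. Qed.

Lemma tclW (P : tens -> Prop) : (forall y x, P (tcl y x)) -> forall z, P z.
Proof. by move=> Pcl z; rewrite -[z]reprK; case: (repr z) => y x; apply: Pcl. Qed.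

Definition tens_l (k : K) (z : tens) : tens :=
  let p := repr z in tcl (lact Y k p.1) p.2.
Definition tens_r (z : tens) (g : G) : tens :=
  let p := repr z in tcl p.1 (ract X p.2 g).

Lemma tens_lE k y x : tens_l k (tcl y x) = tcl (lact Y k y) x.
Proof.
rewrite /tens_l; have : tcl (repr (tcl y x)).1 (repr (tcl y x)).2 = tcl y x.
  by rewrite /tcl -surjective_pairing reprK.
case: (repr (tcl y x)) => y' x' /= /eqP/tcl_eqP [h [-> ->]].
by rewrite -lractA tcl_ract.
Qed.

Lemma tens_rE y x g : tens_r (tcl y x) g = tcl y (ract X x g).
Proof.
rewrite /tens_r; have : tcl (repr (tcl y x)).1 (repr (tcl y x)).2 = tcl y x.
  by rewrite /tcl -surjective_pairing reprK.
case: (repr (tcl y x)) => y' x' /= /eqP/tcl_eqP [h [-> ->]].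
by rewrite lractA tcl_ract.
Qed.

Fact tens_l1 z : tens_l 1%g z = z.
Proof. by elim/tclW: z => y x; rewrite tens_lE lact1. Qed.
Fact tens_lM k k' z : tens_l (k * k')%g z = tens_l k (tens_l k' z).
Proof. by elim/tclW: z => y x; rewrite !tens_lE lactM. Qed.
Fact tens_r1 z : tens_r z 1%g = z.
Proof. by elim/tclW: z => y x; rewrite tens_rE ract1. Qed.
Fact tens_rM z g g' : tens_r z (g * g')%g = tens_r (tens_r z g) g'.
Proof. by elim/tclW: z => y x; rewrite !tens_rE ractM. Qed.
Fact tens_lrA k z g : tens_r (tens_l k z) g = tens_l k (tens_r z g).
Proof. by elim/tclW: z => y x; rewrite tens_lE !tens_rE tens_lE. Qed.

Definition bcomp : biset K G :=
  @Biset K G (quot_type tens) tens_l tens_r tens_l1 tens_lM tens_r1 tens_rM tens_lrA.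

End Composition.

Lemma bcomp_iso (K H G : finGroupType) (Y Y' : biset K H) (X X' : biset H G) :
  biset_iso Y Y' -> biset_iso X X' -> biset_iso (bcomp Y X) (bcomp Y' X').
Proof.
have key : forall (Y Y' : biset K H) (X X' : biset H G) (f : Y -> Y') (g : X -> X'),
    (forall y h, f (ract Y y h) = ract Y' (f y) h) ->
    (forall h x, g (lact X h x) = lact X' h (g x)) ->
  exists F : bcomp Y X -> bcomp Y' X', forall y x, F (tcl y x) = tcl (f y) (g x).
  move=> {Y Y' X X'} Y Y' X X' f g fr gl.
  exists (fun z => tcl (f (repr z).1) (g (repr z).2)) => y x.
  have : tcl (repr (tcl y x)).1 (repr (tcl y x)).2 = tcl y x.
    by rewrite /tcl -surjective_pairing reprK.
  case: (repr (tcl y x)) => y' x' /= /eqP/tcl_eqP [h [-> ->]].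
  by rewrite fr gl tcl_ract.
case=> f [[f' fK f'K] fl fr] [g [[g' gK g'K] gl gr]].
have [F FE] := key _ _ _ _ _ _ fr gl.
have f'r y h : f' (ract Y' y h) = ract Y (f' y) h.
  by apply: (can_inj fK); rewrite f'K fr f'K.
have g'l h x : g' (lact X' h x) = lact X h (g' x).
  by apply: (can_inj gK); rewrite g'K gl g'K.
have [F' F'E] := key _ _ _ _ _ _ f'r g'l.
exists F; split.
- exists F'; elim/tclW=> y x; first by rewrite FE F'E fK gK.
  by rewrite F'E FE f'K g'K.
- by move=> h; elim/tclW=> y x; rewrite /= tens_lE !FE tens_lE fl.
- by move=> z h; elim/tclW: z => y x; rewrite /= tens_rE !FE tens_rE gr.
Qed.

Lemma bcomp_suml (K H G : finGroupType) (Y Y' : biset K H) (X : biset H G) :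
  biset_iso (bcomp (bsum Y Y') X) (bsum (bcomp Y X) (bcomp Y' X)).
Proof.
pose f (z : bcomp (bsum Y Y') X) : bsum (bcomp Y X) (bcomp Y' X) :=
  match (repr z).1 with
  | inl y => inl (tcl y (repr z).2) | inr y => inr (tcl y (repr z).2) end.
pose g (z : bsum (bcomp Y X) (bcomp Y' X)) : bcomp (bsum Y Y') X :=
  match z with
  | inl t => @tcl K H G (bsum Y Y') X (inl (repr t).1) (repr t).2
  | inr t => @tcl K H G (bsum Y Y') X (inr (repr t).1) (repr t).2 end.
have fE (w : bsum Y Y') x : f (tcl w x) = match w with
    inl y => inl (tcl y x) | inr y => inr (tcl y x) end.
  rewrite /f; have : tcl (repr (tcl w x)).1 (repr (tcl w x)).2 = tcl w x.
    by rewrite /tcl -surjective_pairing reprK.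
  case: (repr (tcl w x)) => y' x' /= /eqP/tcl_eqP [h [-> ->]].
  by case: w => y /=; rewrite tcl_ract.
have glE y x : g (inl (tcl y x)) = @tcl K H G (bsum Y Y') X (inl y) x.
  rewrite /g; have : tcl (repr (tcl y x)).1 (repr (tcl y x)).2 = tcl y x.
    by rewrite /tcl -surjective_pairing reprK.
  case: (repr (tcl y x)) => y' x' /= /eqP/tcl_eqP [h [-> ->]].
  by rewrite -tcl_ract.
have grE y x : g (inr (tcl y x)) = @tcl K H G (bsum Y Y') X (inr y) x.
  rewrite /g; have : tcl (repr (tcl y x)).1 (repr (tcl y x)).2 = tcl y x.
    by rewrite /tcl -surjective_pairing reprK.
  case: (repr (tcl y x)) => y' x' /= /eqP/tcl_eqP [h [-> ->]].
  by rewrite -tcl_ract.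
exists f; split.
- exists g; first by elim/tclW=> -[y|y] x; rewrite fE ?glE ?grE.
  by case; elim/tclW=> y x; rewrite ?glE ?grE fE.
- by move=> h; elim/tclW=> -[y|y] x; rewrite /= tens_lE !fE /= tens_lE.
- by move=> z h; elim/tclW: z => -[y|y] x; rewrite /= tens_rE !fE /= tens_rE.
Qed.

Lemma bcomp_sumr (K H G : finGroupType) (Y : biset K H) (X X' : biset H G) :
  biset_iso (bcomp Y (bsum X X')) (bsum (bcomp Y X) (bcomp Y X')).
Proof.
pose f (z : bcomp Y (bsum X X')) : bsum (bcomp Y X) (bcomp Y X') :=
  match (repr z).2 with
  | inl x => inl (tcl (repr z).1 x) | inr x => inr (tcl (repr z).1 x) end.
pose g (z : bsum (bcomp Y X) (bcomp Y X')) : bcomp Y (bsum X X') :=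
  match z with
  | inl t => @tcl K H G Y (bsum X X') (repr t).1 (inl (repr t).2)
  | inr t => @tcl K H G Y (bsum X X') (repr t).1 (inr (repr t).2) end.
have fE y (w : bsum X X') : f (tcl y w) = match w with
    inl x => inl (tcl y x) | inr x => inr (tcl y x) end.
  rewrite /f; have : tcl (repr (tcl y w)).1 (repr (tcl y w)).2 = tcl y w.
    by rewrite /tcl -surjective_pairing reprK.
  case: (repr (tcl y w)) => y' x' /= /eqP/tcl_eqP [h [-> ->]].
  by case: x' => x /=; rewrite tcl_ract.
have glE y x : g (inl (tcl y x)) = @tcl K H G Y (bsum X X') y (inl x).
  rewrite /g; have : tcl (repr (tcl y x)).1 (repr (tcl y x)).2 = tcl y x.
    by rewrite /tcl -surjective_pairing reprK.
  case: (repr (tcl y x)) => y' x' /= /eqP/tcl_eqP [h [-> ->]].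
  by rewrite tcl_ract.
have grE y x : g (inr (tcl y x)) = @tcl K H G Y (bsum X X') y (inr x).
  rewrite /g; have : tcl (repr (tcl y x)).1 (repr (tcl y x)).2 = tcl y x.
    by rewrite /tcl -surjective_pairing reprK.
  case: (repr (tcl y x)) => y' x' /= /eqP/tcl_eqP [h [-> ->]].
  by rewrite tcl_ract.
exists f; split.
- exists g; first by elim/tclW=> y [x|x]; rewrite fE ?glE ?grE.
  by case; elim/tclW=> y x; rewrite ?glE ?grE fE.
- by move=> h; elim/tclW=> y [x|x]; rewrite /= tens_lE !fE /= tens_lE.
- by move=> z h; elim/tclW: z => y [x|x]; rewrite /= tens_rE !fE /= tens_rE.
Qed.

Definition breg (G : finGroupType) : biset G G :=
  @Biset G G G (fun h x => h * x)%g (fun x g => x * g)%g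
    (@mul1g G) (fun h h' x => esym (mulgA h h' x))
    (@mulg1 G) (fun x g g' => mulgA x g g')
    (fun h x g => esym (mulgA h x g)).

(* The finite (H,G)-bisets form a proper class; every one of them is *)
(* isomorphic to its encoding on some {0, .., n-1}, so that the encoded ones *)
(* are a small set of generators for the Burnside module. *)
Record obiset (H G : finGroupType) := OBiset {
  osize : nat;
  olact : H -> 'I_osize -> 'I_osize;
  oract : 'I_osize -> G -> 'I_osize;
  olact1 : forall x, olact 1%g x = x;
  olactM : forall h h' x, olact (h * h')%g x = olact h (olact h' x);
  oract1 : forall x, oract x 1%g = x;
  oractM : forall x g g', oract x (g * g')%g = oract (oract x g) g';
  olractA : forall h x g, oract (olact h x) g = olact h (oract x g) }.

HB.instance Definition _ (H G : finGroupType) := gen_eqMixin (obiset H G).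
HB.instance Definition _ (H G : finGroupType) := gen_choiceMixin (obiset H G).

Coercion obiset_biset (H G : finGroupType) (X : obiset H G) : biset H G :=
  @Biset H G 'I_(osize X) (@olact H G X) (@oract H G X)
    (@olact1 H G X) (@olactM H G X) (@oract1 H G X) (@oractM H G X) (@olractA H G X).

Section Encode.
Variables (H G : finGroupType) (X : biset H G).

Let el (h : H) (i : 'I_#|X|) := enum_rank (lact X h (enum_val i)).
Let er (i : 'I_#|X|) (g : G) := enum_rank (ract X (enum_val i) g).

Fact el1 i : el 1%g i = i.
Proof. by rewrite /el lact1 enum_valK. Qed.
Fact elM h h' i : el (h * h')%g i = el h (el h' i).
Proof. by rewrite /el enum_rankK lactM. Qed.
Fact er1 i : er i 1%g = i.
Proof. by rewrite /er ract1 enum_valK. Qed.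
Fact erM i g g' : er i (g * g')%g = er (er i g) g'.
Proof. by rewrite /er enum_rankK ractM. Qed.
Fact elrA h i g : er (el h i) g = el h (er i g).
Proof. by rewrite /er /el !enum_rankK lractA. Qed.

Definition encode : obiset H G :=
  @OBiset H G #|X| el er el1 elM er1 erM elrA.

Lemma encode_iso : biset_iso encode X.
Proof.
exists (fun i => enum_val (i : 'I_#|X|)); split.
- by exists enum_rank => x; rewrite ?enum_valK ?enum_rankK.
- by move=> h i /=; rewrite enum_rankK.
- by move=> i g /=; rewrite enum_rankK.
Qed.

End Encode.

Section Burnside.
Variables (k : comPzRingType) (H G : finGroupType).

(* A list [:: (a_1, X_1); ..; (a_n, X_n)] stands for the formal linear *)
(* combination a_1 [X_1] + .. + a_n [X_n]. *)
Definition bterm := seq (k * obiset H G).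

(* The k-module presented by the generators [X], with relations [X] = [Y] *)
(* for isomorphic X and Y, and [X + Y] = [X] + [Y] for disjoint unions. *)
(* Since tensoring is right exact this is k (x) B(H,G); for k = int it is the *)
(* Grothendieck group B(H,G) itself. *)
Inductive bequiv : bterm -> bterm -> Prop :=
| bequiv_refl s : bequiv s s
| bequiv_sym s t : bequiv s t -> bequiv t s
| bequiv_trans s t u : bequiv s t -> bequiv t u -> bequiv s u
| bequiv_cat s s' t t' : bequiv s s' -> bequiv t t' -> bequiv (s ++ t) (s' ++ t')
| bequiv_catC s t : bequiv (s ++ t) (t ++ s)
| bequiv_coef0 X : bequiv [:: (0, X)] [::]
| bequiv_coefD a b X : bequiv [:: (a + b, X)] [:: (a, X); (b, X)]
| bequiv_iso a (X Y : obiset H G) :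
    biset_iso X Y -> bequiv [:: (a, X)] [:: (a, Y)]
| bequiv_sum a (X Y Z : obiset H G) :
    biset_iso Z (bsum X Y) -> bequiv [:: (a, Z)] [:: (a, X); (a, Y)].

Definition brel (s t : bterm) : bool := `[< bequiv s t >].

Fact brel_refl : reflexive brel.
Proof. by move=> s; apply/asboolP; apply: bequiv_refl. Qed.
Fact brel_sym : symmetric brel.
Proof. by move=> s t; apply/asboolP/asboolP; apply: bequiv_sym. Qed.
Fact brel_trans : transitive brel.
Proof.
by move=> t s u /asboolP st /asboolP tu; apply/asboolP; apply: bequiv_trans tu.
Qed.

Canonical brel_equiv := EquivRel brel brel_refl brel_sym brel_trans.

Definition burnside := {eq_quot brel_equiv}.
HB.instance Definition _ := Choice.on burnside.

Definition bpi (s : bterm) : burnside := \pi_({eq_quot brel_equiv}) s.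

Lemma bpi_eqP s t : bpi s = bpi t <-> bequiv s t.
Proof.
split=> [/eqP|st]; last apply/eqP.
  by rewrite eqmodE => /asboolP.
by rewrite eqmodE; apply/asboolP.
Qed.

Lemma bpi_repr (x : burnside) : bpi (repr x) = x.
Proof. exact: reprK. Qed.

Lemma bpiW (P : burnside -> Prop) : (forall s, P (bpi s)) -> forall x, P x.
Proof. by move=> Ps x; rewrite -[x]bpi_repr; apply: Ps. Qed.

Lemma repr_bpi s : bequiv (repr (bpi s)) s.
Proof. by apply/bpi_eqP; rewrite bpi_repr. Qed.

Definition bterm_scale (a : k) (s : bterm) : bterm :=
  [seq (a * p.1, p.2) | p <- s].

Lemma bterm_scale_equiv a s t :
  bequiv s t -> bequiv (bterm_scale a s) (bterm_scale a t).
Proof.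
elim=> {s t}.
- by move=> s; apply: bequiv_refl.
- by move=> s t _; apply: bequiv_sym.
- by move=> s t u _ st _; apply: bequiv_trans.
- by move=> s s' t t' _ ss _ tt; rewrite /bterm_scale !map_cat; apply: bequiv_cat.
- by move=> s t; rewrite /bterm_scale !map_cat; apply: bequiv_catC.
- by move=> X; rewrite /= mulr0; apply: bequiv_coef0.
- by move=> b c X; rewrite /= mulrDr; apply: bequiv_coefD.
- by move=> b X Y XY; apply: bequiv_iso.
- by move=> b X Y Z XY; apply: bequiv_sum.
Qed.

Definition bzero : burnside := bpi [::].
Definition badd (x y : burnside) : burnside := bpi (repr x ++ repr y).
Definition bscale (a : k) (x : burnside) : burnside := bpi (bterm_scale a (repr x)).
Definition bopp (x : burnside) : burnside := bscale (-1) x.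

Lemma baddE s t : badd (bpi s) (bpi t) = bpi (s ++ t).
Proof. by apply/bpi_eqP; apply: bequiv_cat; apply: repr_bpi. Qed.

Lemma bscaleE a s : bscale a (bpi s) = bpi (bterm_scale a s).
Proof. by apply/bpi_eqP; apply: bterm_scale_equiv; apply: repr_bpi. Qed.

Fact baddA : associative badd.
Proof.
by elim/bpiW=> s; elim/bpiW=> t; elim/bpiW=> u; rewrite !baddE catA.
Qed.

Fact baddC : commutative badd.
Proof.
by elim/bpiW=> s; elim/bpiW=> t; rewrite !baddE; apply/bpi_eqP; apply: bequiv_catC.
Qed.

Fact badd0 : left_id bzero badd.
Proof. by elim/bpiW=> s; rewrite /bzero baddE. Qed.

Lemma bterm_scaleDl a b s :
  bequiv (bterm_scale (a + b) s) (bterm_scale a s ++ bterm_scale b s).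
Proof.
elim: s => [|[c X] s IHs] /=; first exact: bequiv_refl.
apply: (@bequiv_trans _ ([:: (a * c, X); (b * c, X)] ++
                         (bterm_scale a s ++ bterm_scale b s))).
  by apply: (bequiv_cat (s := [:: _])); rewrite // mulrDl; apply: bequiv_coefD.
apply: (bequiv_cat (s := [:: _]) (s' := [:: _])); first exact: bequiv_refl.
apply: (@bequiv_trans _ (([:: (b * c, X)] ++ bterm_scale a s) ++ bterm_scale b s)).
  exact: bequiv_refl.
rewrite -[_ :: bterm_scale b s]cat1s catA.
by apply: bequiv_cat; [apply: bequiv_catC | apply: bequiv_refl].
Qed.

Lemma bterm_scale0 s : bequiv (bterm_scale 0 s) [::].
Proof.
elim: s => [|[c X] s IHs] /=; first exact: bequiv_refl.
apply: (bequiv_cat (s := [:: _]) (s' := [::])) => //.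
by rewrite mul0r; apply: bequiv_coef0.
Qed.

Lemma bterm_scale1 s : bterm_scale 1 s = s.
Proof. by elim: s => [|[c X] s IHs] //=; rewrite IHs mul1r. Qed.

Fact baddN : left_inverse bzero bopp badd.
Proof.
elim/bpiW=> s; rewrite /bopp bscaleE baddE; apply/bpi_eqP.
rewrite -[in X in _ ++ X](bterm_scale1 s).
apply: bequiv_trans (bequiv_sym (bterm_scaleDl _ _ _)) _.
by rewrite addNr; apply: bterm_scale0.
Qed.

HB.instance Definition _ := GRing.isZmodule.Build burnside baddA baddC badd0 baddN.

Fact bscaleA a b x : bscale a (bscale b x) = bscale (a * b) x.
Proof.
elim/bpiW: x => s; rewrite !bscaleE; congr bpi.
by rewrite /bterm_scale -map_comp; apply: eq_map => p /=; rewrite mulrA.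
Qed.

Fact bscale1 : left_id 1 bscale.
Proof. by elim/bpiW=> s; rewrite bscaleE bterm_scale1. Qed.

Fact bscaleDr : right_distributive bscale +%R.
Proof.
move=> a; elim/bpiW=> s; elim/bpiW=> t.
by rewrite -[_ + bpi t]/(badd _ _) baddE !bscaleE -[RHS]/(badd _ _) baddE -map_cat.
Qed.

Fact bscaleDl x : {morph bscale^~ x : a b / a + b}.
Proof.
move=> a b; elim/bpiW: x => s; rewrite !bscaleE -[RHS]/(badd _ _) baddE.
by apply/bpi_eqP; apply: bterm_scaleDl.
Qed.

HB.instance Definition _ := GRing.Zmodule_isLmodule.Build k burnside
  bscaleA bscale1 bscaleDr bscaleDl.

Definition bgen (X : obiset H G) : burnside := bpi [:: (1, X)].

Definition bclass (X : biset H G) : burnside := bgen (encode X).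

Lemma bpiE s : bpi s = \sum_(p <- s) p.1 *: bgen p.2.
Proof.
elim: s => [|[a X] s IHs]; first by rewrite big_nil.
rewrite big_cons -IHs /= -[_ *: _]/(bscale _ _) bscaleE -[RHS]/(badd _ _) baddE /=.
by rewrite mulr1.
Qed.

Lemma bgen_iso (X Y : obiset H G) : biset_iso X Y -> bgen X = bgen Y.
Proof. by move=> XY; apply/bpi_eqP; apply: bequiv_iso. Qed.

Lemma bgen_class (X : obiset H G) : bgen X = bclass X.
Proof. exact/bgen_iso/biset_iso_sym/encode_iso. Qed.

Lemma bclass_iso (X Y : biset H G) : biset_iso X Y -> bclass X = bclass Y.
Proof.
move=> XY; apply: bgen_iso; apply: biset_iso_trans (encode_iso _) _.
exact: biset_iso_trans XY (biset_iso_sym (encode_iso _)).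
Qed.

Lemma bsum_iso (X X' Y Y' : biset H G) :
  biset_iso X X' -> biset_iso Y Y' -> biset_iso (bsum X Y) (bsum X' Y').
Proof.
case=> f [[f' fK f'K] fl fr] [g [[g' gK g'K] gl gr]].
exists (fun z : bsum X Y => match z with inl x => inl (f x) | inr y => inr (g y) end).
split.
- exists (fun z => match z with inl x => inl (f' x) | inr y => inr (g' y) end).
    by case=> z; rewrite ?fK ?gK.
  by case=> z; rewrite ?f'K ?g'K.
- by move=> h [z|z] /=; rewrite ?fl ?gl.
- by move=> [z|z] h /=; rewrite ?fr ?gr.
Qed.

Lemma bclass_sum (X Y : biset H G) : bclass (bsum X Y) = bclass X + bclass Y.
Proof.
rewrite -[RHS]/(badd _ _) baddE; apply/bpi_eqP; apply: bequiv_sum.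
apply: biset_iso_trans (encode_iso _) _.
by apply: bsum_iso; apply/biset_iso_sym/encode_iso.
Qed.

Section Lift.
Variables (V : lmodType k) (f : obiset H G -> V).

(* The linear extension of f, for f compatible with the relations. *)
Definition blift (x : burnside) : V := \sum_(p <- repr x) p.1 *: f p.2.

Hypothesis f_iso : forall X Y : obiset H G, biset_iso X Y -> f X = f Y.
Hypothesis f_sum :
  forall X Y Z : obiset H G, biset_iso Z (bsum X Y) -> f Z = f X + f Y.

Lemma bliftE s : blift (bpi s) = \sum_(p <- s) p.1 *: f p.2.
Proof.
suff ext s1 s2 : bequiv s1 s2 ->
    \sum_(p <- s1) p.1 *: f p.2 = \sum_(p <- s2) p.1 *: f p.2.
  exact/ext/repr_bpi.
elim=> {s1 s2}.
- by [].
- by [].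
- by move=> s1 s2 s3 _ -> _ ->.
- by move=> s1 s2 t1 t2 _ e1 _ e2; rewrite !big_cat /= e1 e2.
- by move=> s1 s2; rewrite !big_cat /= addrC.
- by move=> X; rewrite big_seq1 big_nil scale0r.
- by move=> a b X; rewrite !big_cons !big_nil !addr0 scalerDl.
- by move=> a X Y XY; rewrite !big_seq1 (f_iso XY).
- by move=> a X Y Z XY; rewrite !big_cons !big_nil !addr0 /= (f_sum XY) scalerDr.
Qed.

Lemma blift_is_linear a x y : blift (a *: x + y) = a *: blift x + blift y.
Proof.
elim/bpiW: x => s; elim/bpiW: y => t.
rewrite -[a *: bpi s]/(bscale _ _) bscaleE -[_ + bpi t]/(badd _ _) baddE !bliftE.
rewrite big_cat /= big_map scaler_sumr; congr (_ + _).
by apply: eq_bigr => p _; rewrite scalerA.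
Qed.

Lemma blift_gen X : blift (bgen X) = f X.
Proof. by rewrite bliftE big_seq1 scale1r. Qed.

End Lift.

End Burnside.

(* Composition of kD: the bilinear extension of the composition of bisets. *)
Definition bdot (k : comPzRingType) (K H G : finGroupType)
    (y : burnside k K H) (x : burnside k H G) : burnside k K G :=
  blift (fun Y => blift (fun X => bclass k (bcomp Y X)) x) y.

Definition bid (k : comPzRingType) (G : finGroupType) : burnside k G G :=
  bclass k (breg G).

Section CompositionTheory.
Variables (k : comPzRingType) (K H G : finGroupType).

Let comp_isor (Y : biset K H) (X X' : obiset H G) :
  biset_iso X X' -> bclass k (bcomp Y X) = bclass k (bcomp Y X').
Proof. by move=> XX; apply/bclass_iso/bcomp_iso => //; apply: biset_iso_refl. Qed.

Let comp_sumr (Y : biset K H) (X X' Z : obiset H G) : biset_iso Z (bsum X X') ->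
  bclass k (bcomp Y Z) = bclass k (bcomp Y X) + bclass k (bcomp Y X').
Proof.
move=> XX; rewrite -bclass_sum; apply: bclass_iso.
by apply: biset_iso_trans (bcomp_iso (biset_iso_refl _) XX) (bcomp_sumr _ _ _).
Qed.

Let dot_isol (x : burnside k H G) (Y Y' : obiset K H) : biset_iso Y Y' ->
  blift (fun X => bclass k (bcomp Y X)) x = blift (fun X => bclass k (bcomp Y' X)) x.
Proof.
move=> YY; apply: eq_bigr => p _; congr (_ *: _).
exact/bclass_iso/bcomp_iso/biset_iso_refl.
Qed.

Let dot_suml (x : burnside k H G) (Y Y' Z : obiset K H) : biset_iso Z (bsum Y Y') ->
  blift (fun X => bclass k (bcomp Z X)) x =
  blift (fun X => bclass k (bcomp Y X)) x + blift (fun X => bclass k (bcomp Y' X)) x.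
Proof.
move=> YY; rewrite -big_split; apply: eq_bigr => p _ /=.
rewrite -scalerDr -bclass_sum; congr (_ *: _); apply: bclass_iso.
by apply: biset_iso_trans (bcomp_iso YY (biset_iso_refl _)) (bcomp_suml _ _ _).
Qed.

Lemma bdot_linearl (x : burnside k H G) a (y y' : burnside k K H) :
  bdot (a *: y + y') x = a *: bdot y x + bdot y' x.
Proof. exact: (blift_is_linear (dot_isol x) (@dot_suml x)). Qed.

Lemma bdot_linearr (y : burnside k K H) a (x x' : burnside k H G) :
  bdot y (a *: x + x') = a *: bdot y x + bdot y x'.
Proof.
have E z : bdot y z =
  \sum_(p <- repr y) p.1 *: blift (fun X => bclass k (bcomp p.2 X)) z by [].
rewrite !E scaler_sumr -big_split; apply: eq_bigr => p _ /=.
rewrite (blift_is_linear (@comp_isor p.2) (@comp_sumr p.2)).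
by rewrite scalerDr !scalerA mulrC.
Qed.

Lemma bdot_class (Y : biset K H) (X : biset H G) :
  bdot (bclass k Y) (bclass k X) = bclass k (bcomp Y X).
Proof.
rewrite /bdot (blift_gen (dot_isol _) (@dot_suml _)).
rewrite (blift_gen (@comp_isor _) (@comp_sumr _)).
by apply/bclass_iso/bcomp_iso; apply: encode_iso.
Qed.

End CompositionTheory.

Section HomBisets.
Variables (G H : finGroupType) (phi : {multiplicative G -> H}).

Fact mult1 : (phi 1 = 1)%g.
Proof. by apply: (mulgI (phi 1%g)); rewrite -gmulfM !mulg1. Qed.

Fact ind_r1 (x : H) : (x * phi 1)%g = x.
Proof. by rewrite mult1 mulg1. Qed.
Fact ind_rM (x : H) (g g' : G) : (x * phi (g * g') = x * phi g * phi g')%g.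
Proof. by rewrite gmulfM mulgA. Qed.

Definition Ind : biset H G :=
  @Biset H G H (fun h x => h * x)%g (fun x g => x * phi g)%g
    (@mul1g H) (fun h h' x => esym (mulgA h h' x))
    ind_r1 ind_rM (fun h x g => esym (mulgA h x (phi g))).

Fact res_l1 (x : H) : (phi 1 * x)%g = x.
Proof. by rewrite mult1 mul1g. Qed.
Fact res_lM (g g' : G) (x : H) : (phi (g * g') * x = phi g * (phi g' * x))%g.
Proof. by rewrite gmulfM -mulgA. Qed.

Definition Res : biset G H :=
  @Biset G H H (fun g x => phi g * x)%g (fun x h => x * h)%g
    res_l1 res_lM (@mulg1 H) (fun x h h' => mulgA x h h')
    (fun g x h => esym (mulgA (phi g) x h)).

End HomBisets.

(* Iso(phi), to be used for bijective phi only. *)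
Notation Iso := Ind (only parsing).

Definition swap (G H : finGroupType) (p : (G * H)%type) : (H * G)%type := (p.2, p.1).
Fact swapM (G H : finGroupType) : {morph @swap G H : x y / (x * y)%g}.
Proof. by []. Qed.
HB.instance Definition _ (G H : finGroupType) :=
  isMultiplicative.Build (G * H)%type (H * G)%type (@swap G H) (@swapM G H).

Definition diag (G : finGroupType) (g : G) : (G * G)%type := (g, g).
Fact diagM (G : finGroupType) : {morph @diag G : x y / (x * y)%g}.
Proof. by []. Qed.
HB.instance Definition _ (G : finGroupType) :=
  isMultiplicative.Build G (G * G)%type (@diag G) (@diagM G).

(* 'I_1 with the additive group law, the trivial group. *)
Definition grp1 : finGroupType := 'I_1.

Section ArrowRight.
Variable G : finGroupType.
Let la (p : (G * G)%type) (g : G) : G := (p.1 * g * p.2^-1)%g.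

Fact arr_l1 g : la 1%g g = g.
Proof. by rewrite /la /= invg1 mulg1 mul1g. Qed.
Fact arr_lM p q g : la (p * q)%g g = la p (la q g).
Proof. by rewrite /la /= invMg !mulgA. Qed.

Definition rarrow : biset (G * G)%type grp1 :=
  @Biset (G * G)%type grp1 G la (fun g _ => g)
    arr_l1 arr_lM (fun _ => erefl) (fun _ _ _ => erefl) (fun _ _ _ => erefl).

End ArrowRight.

Section ArrowLeft.
Variables K H G : finGroupType.
Let T := (K * H * G)%type.
Let la (p : (K * G)%type) (t : T) : T :=
  (p.1 * t.1.1, t.1.2, p.2 * t.2)%g.
Let ra (t : T) (q : ((K * H) * (H * G))%type) : T :=
  (t.1.1 * q.1.1, q.1.2^-1 * t.1.2 * q.2.1, t.2 * q.2.2)%g.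

Fact arl_l1 t : la 1%g t = t.
Proof. by case: t => -[x y] z; rewrite /la /= !mul1g. Qed.
Fact arl_lM p q t : la (p * q)%g t = la p (la q t).
Proof. by case: t => -[x y] z; rewrite /la /= !mulgA. Qed.
Fact arl_r1 t : ra t 1%g = t.
Proof. by case: t => -[x y] z; rewrite /ra /= invg1 mul1g !mulg1. Qed.
Fact arl_rM t p q : ra t (p * q)%g = ra (ra t p) q.
Proof. by case: t => -[x y] z; rewrite /ra /= invMg !mulgA. Qed.
Fact arl_lrA p t q : ra (la p t) q = la p (ra t q).
Proof. by case: t => -[x y] z; rewrite /ra /la /= !mulgA. Qed.

Definition larrow : biset (K * G)%type ((K * H) * (H * G))%type :=
  @Biset (K * G)%type ((K * H) * (H * G))%type T la ra
    arl_l1 arl_lM arl_r1 arl_rM arl_lrA.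

End ArrowLeft.

(* A full subcategory of the biset category is given by its class of objects. *)
(* Closure under subquotients is understood up to isomorphism. *)
(* Nonemptiness only serves to have the trivial group among the objects. *)
Record biset_subcat := BisetSubcat {
  inD :> finGroupType -> Prop;
  inD_nonempty : exists G, inD G;
  inD_subquotient : forall (G Q : finGroupType) (M N : {group G}),
    inD G -> (N <| M)%g -> ([set: Q] \isog M / N)%g -> inD Q;
  inD_prod : forall G H : finGroupType, inD G -> inD H -> inD (G * H)%type }.

Record dobj (D : biset_subcat) := Dobj {
  dgrp :> finGroupType;
  dobjP : D dgrp }.

Section Objects.
Variable D : biset_subcat.

Definition dobj_prod (G H : dobj D) : dobj D :=
  Dobj (inD_prod (dobjP G) (dobjP H)).

Fact inD_grp1 : D grp1.
Proof.
case: (inD_nonempty D) => G DG.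
apply: (@inD_subquotient D G grp1 1%G 1%G DG (normal1 _)).
apply: trivial_isog; last exact: trivg_quotient.
by apply/trivgP/subsetP => x _; rewrite inE [x]ord1.
Qed.

Definition dobj1 : dobj D := Dobj inD_grp1.

End Objects.

(* Unital associative k-algebras, the zero algebra included (the library's *)
(* algType excludes it). *)
Record kAlgebra (k : comPzRingType) := KAlgebra {
  kmodule : lmodType k;
  kone : kmodule;
  kmul : kmodule -> kmodule -> kmodule;
  kmulA : associative kmul;
  kmul1r : left_id kone kmul;
  kmulr1 : right_id kone kmul;
  kmulDl : left_distributive kmul +%R;
  kmulDr : right_distributive kmul +%R;
  kscaleAl : forall (a : k) x y, a *: kmul x y = kmul (a *: x) y;
  kscaleAr : forall (a : k) x y, a *: kmul x y = kmul x (a *: y) }.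

Definition kcar (k : comPzRingType) (A : kAlgebra k) : Type := kmodule A.
Coercion kcar : kAlgebra >-> Sortclass.

HB.instance Definition _ (k : comPzRingType) (A : kAlgebra k) :=
  GRing.Lmodule.on (kcar A).
HB.instance Definition _ (k : comPzRingType) (A : kAlgebra k) :=
  GRing.Zmodule_isPzRing.Build (kcar A)
    (@kmulA k A) (@kmul1r k A) (@kmulr1 k A) (@kmulDl k A) (@kmulDr k A).

(* k-linear functors from kD to k-modules; x is sent to F x : F(G) -> F(H) for *)
(* every morphism x in k (x) B(H,G). *)
Definition is_biset_functor (k : comPzRingType) (D : biset_subcat)
    (F : dobj D -> lmodType k)
    (act : forall G H : dobj D, burnside k H G -> {linear F G -> F H}) : Prop :=
  [/\ forall (G H : dobj D) (c : k) (x y : burnside k H G) a,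
        act G H (c *: x + y) a = c *: act G H x a + act G H y a,
      forall (G : dobj D) a, act G G (bid k G) a = a
    & forall (G H K : dobj D) (y : burnside k K H) (x : burnside k H G) a,
        act G K (bdot y x) a = act H K y (act G H x a)].

Record green_functor (k : comPzRingType) (D : biset_subcat) := GreenFunctor {
  gobj :> dobj D -> kAlgebra k;
  gact : forall G H : dobj D, burnside k H G -> {linear gobj G -> gobj H};
  gact_functor : is_biset_functor (@gact);
  gact_res1 : forall (G H : dobj D) (phi : {multiplicative G -> H}),
    @gact H G (bclass k (Res phi)) 1 = 1;
  gact_resM : forall (G H : dobj D) (phi : {multiplicative G -> H}) (a b : gobj H),
    @gact H G (bclass k (Res phi)) (a * b) =
    @gact H G (bclass k (Res phi)) a * @gact H G (bclass k (Res phi)) b;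
  gact_frobl : forall (G H : dobj D) (phi : {multiplicative G -> H})
      (a : gobj H) (b : gobj G),
    a * @gact G H (bclass k (Ind phi)) b =
    @gact G H (bclass k (Ind phi)) (@gact H G (bclass k (Res phi)) a * b);
  gact_frobr : forall (G H : dobj D) (phi : {multiplicative G -> H})
      (a : gobj H) (b : gobj G),
    @gact G H (bclass k (Ind phi)) b * a =
    @gact G H (bclass k (Ind phi)) (b * @gact H G (bclass k (Res phi)) a) }.

Arguments gact {k D} A G H x : rename.

Definition gbis (k : comPzRingType) (D : biset_subcat) (A : green_functor k D)
    (G H : dobj D) (X : biset H G) : A G -> A H :=
  gact A G H (bclass k X).
Arguments gbis {k D} A G H X a.

Section AssociatedCategory.
Variables (k : comPzRingType) (D : biset_subcat) (A : green_functor k D).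

Definition gcross (G H : dobj D) (a : A G) (b : A H) : A (dobj_prod G H) :=
  gbis A G (dobj_prod G H) (Res (fst : {multiplicative (G * H)%type -> G})) a *
  gbis A H (dobj_prod G H) (Res (snd : {multiplicative (G * H)%type -> H})) b.

Definition geps : A (dobj1 D) := 1.

Definition PHom (G H : dobj D) : kAlgebra k := A (dobj_prod H G).

Definition Pcomp (G H K : dobj D) (alpha : PHom H K) (beta : PHom G H) : PHom G K :=
  gbis A (dobj_prod (dobj_prod K H) (dobj_prod H G)) (dobj_prod K G) (larrow K H G)
    (gcross alpha beta).

Definition Pid (G : dobj D) : PHom G G :=
  gbis A (dobj1 D) (dobj_prod G G) (rarrow G) geps.

Definition Pinverse (G H : dobj D) (f : PHom G H) (g : PHom H G) : Prop :=
  Pcomp g f = Pid G /\ Pcomp f g = Pid H.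

Definition gtilde (G : dobj D) (a : A G) : PHom G G :=
  gbis A G (dobj_prod G G) (Ind (@diag G)) a.

End AssociatedCategory.

Record star_green_functor (k : comPzRingType) (D : biset_subcat) := StarGreenFunctor {
  sgreen :> green_functor k D;
  star : forall G : dobj D, {linear sgreen G -> sgreen G};
  star_natural : forall (G H : dobj D) (x : burnside k H G) (a : sgreen G),
    star H (gact sgreen G H x a) = gact sgreen G H x (star G a);
  starK : forall (G : dobj D) (a : sgreen G), star G (star G a) = a;
  starM : forall (G : dobj D) (a b : sgreen G),
    star G (a * b) = star G b * star G a }.

Arguments star {k D} A {G} : rename.

Section Orthogonality.
Variables (k : comPzRingType) (D : biset_subcat) (A : star_green_functor k D).

Definition bullet (G H : dobj D) (alpha : PHom A G H) : PHom A H G :=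
  gbis A (dobj_prod H G) (dobj_prod G H) (Iso (@swap H G)) (star A alpha).

Definition inverses (G : dobj D) (u v : A G) : Prop := u * v = 1 /\ v * u = 1.

Definition is_unit (G : dobj D) (u : A G) : Prop := exists v, inverses u v.

Definition orthogonal_unit (G : dobj D) (u : A G) : Prop :=
  exists2 v, inverses u v & star A u = v.

Definition orthogonal_aut (G : dobj D) (w : PHom A G G) : Prop :=
  exists2 w', Pinverse w w' & bullet w = w'.

End Orthogonality.

(* Main.v *)
From Pilot Require Import Defs.
From mathcomp Require Import all_boot all_order all_algebra all_fingroup.
From HB Require Import structures.
From mathcomp Require Import boolp.
(* Restores [lact] and [ract], which the group library shadows. *)
Import Pilot.Defs.

Set Implicit Arguments.
Unset Strict Implicit.
Unset Printing Implicit Defensive.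

Import GRing.Theory.
Local Open Scope ring_scope.

(* Everything rests on two isomorphisms of bisets. A Mackey square gives
   [Ind f a x Ind g b = Ind (f x g) (a x b)], and composing the left arrow with
   [Ind (Delta x Delta)] gives [Ind Delta o Res Delta], so that
   [a~ o b~ = Ind Delta (Res Delta (a x b)) = (a b)~]. Moreover [~] commutes with
   the dualities because [swap o Delta = Delta], and it is injective because
   the first projection is a retraction of [Delta]. *)

(** * Composites of induction and restriction bisets *)

(** A balanced map whose fibres are single [H]-orbits descends to an injection on the tensor product
    over [H]; surjectivity and equivariance then make it an isomorphism. Later proofs only need to
    give [f] on pairs. *)
Lemma bcomp_isoP (K H G : finGroupType) (Y : biset K H) (X : biset H G)
    (Z : biset K G) (f : Y -> X -> Z) :
  (forall y h x, f (ract Y y h) x = f y (lact X h x)) ->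
  (forall y x y' x', f y x = f y' x' ->
     exists h, y = ract Y y' h /\ x' = lact X h x) ->
  (forall z, exists p : Y * X, f p.1 p.2 = z) ->
  (forall c y x, f (lact Y c y) x = lact Z c (f y x)) ->
  (forall y x g, f y (ract X x g) = ract Z (f y x) g) ->
  biset_iso (bcomp Y X) Z.
Proof.
move=> fbal finj /choice [s fs] fl fr.
pose F (z : bcomp Y X) := f (generic_quotient.repr z).1 (generic_quotient.repr z).2.
have FE y x : F (tcl y x) = f y x.
  rewrite /F; set p := generic_quotient.repr _.
  have : tcl p.1 p.2 = tcl y x.
    by rewrite /tcl -surjective_pairing generic_quotient.reprK.
  by move/eqP/tcl_eqP => [h [-> ->]]; rewrite fbal.
exists F; split.
- exists (fun z => tcl (s z).1 (s z).2) => [|z]; last by rewrite FE fs.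
  elim/tclW=> y x; rewrite FE; apply/eqP/tcl_eqP.
  exact/finj/fs.
- by move=> c; elim/tclW=> y x; rewrite /= tens_lE !FE fl.
- by move=> z g; elim/tclW: z => y x; rewrite /= tens_rE !FE fr.
Qed.

(** The class of [(y, x)] is that of [(y * g x, 1)]. The composite [h] is a separate homomorphism
    specified pointwise, so that [swap] after [diag] can be read as [diag]. *)
Lemma Ind_comp (G H K : finGroupType) (f : {multiplicative G -> H})
    (g : {multiplicative H -> K}) (h : {multiplicative G -> K}) :
  (forall x, h x = g (f x)) -> biset_iso (bcomp (Ind g) (Ind f)) (Ind h).
Proof.
move=> hE; apply: (@bcomp_isoP _ _ _ (Ind g) (Ind f) (Ind h) (fun y x => y * g x)%g).
- by move=> y c x /=; rewrite gmulfM mulgA.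
- move=> y x y' x' /= e; exists (x' * x^-1)%g; split; last by rewrite mulgKV.
  apply: (mulIg (g x)).
  by rewrite -mulgA -gmulfM mulgKV.
- by move=> z; exists (z, 1%g); rewrite /= mult1 mulg1.
- by move=> c y x /=; rewrite mulgA.
- by move=> y x c /=; rewrite hE gmulfM mulgA.
Qed.

Lemma Res_comp (G H K : finGroupType) (f : {multiplicative G -> H})
    (g : {multiplicative H -> K}) (h : {multiplicative G -> K}) :
  (forall x, h x = g (f x)) -> biset_iso (bcomp (Res f) (Res g)) (Res h).
Proof.
move=> hE; apply: (@bcomp_isoP _ _ _ (Res f) (Res g) (Res h) (fun y x => g y * x)%g).
- by move=> y c x /=; rewrite gmulfM mulgA.
- move=> y x y' x' /= e; exists (y'^-1 * y)%g; split; first by rewrite mulKVg.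
  apply: (mulgI (g y')).
  by rewrite mulgA -gmulfM mulKVg.
- by move=> z; exists (1%g, z); rewrite /= mult1 mul1g.
- by move=> c y x /=; rewrite hE gmulfM mulgA.
- by move=> y x c /=; rewrite mulgA.
Qed.

Lemma Ind_id (G : finGroupType) (f : {multiplicative G -> G}) :
  f =1 id -> biset_iso (Ind f) (breg G).
Proof. by move=> fE; exists id; split=> // [|x g /=]; [exists id | rewrite fE]. Qed.

Lemma Res_id (G : finGroupType) (f : {multiplicative G -> G}) :
  f =1 id -> biset_iso (Res f) (breg G).
Proof. by move=> fE; exists id; split=> // [|x g /=]; [exists id | rewrite fE]. Qed.

(** Mackey formula with a single double coset, as [f] is onto; [P] covers the fibre product of [f]
    and [g]. Both composites are identified with [H], on which [K] acts through [f] and [G] through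
    [g]. *)
Lemma Res_Ind_pullback (P K G H : finGroupType) (p : {multiplicative P -> K})
    (q : {multiplicative P -> G}) (f : {multiplicative K -> H})
    (g : {multiplicative G -> H}) :
  (forall c, f (p c) = g (q c)) ->
  (forall x y, f x = g y -> exists c, x = p c /\ y = q c) ->
  (forall z, exists x, f x = z) ->
  biset_iso (bcomp (Res f) (Ind g)) (bcomp (Ind p) (Res q)).
Proof.
move=> comm pull fsurj.
pose Z := @Biset K G H (fun c z => f c * z)%g (fun z c => z * g c)%g
  (@res_l1 _ _ f) (@res_lM _ _ f) (@ind_r1 _ _ g) (@ind_rM _ _ g)
  (fun c z d => esym (mulgA (f c) z (g d))).
apply: (@biset_iso_trans _ _ _ Z).
  apply: (@bcomp_isoP _ _ _ (Res f) (Ind g) Z (fun y x => y * x)%g).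
  - by move=> y c x /=; rewrite mulgA.
  - move=> y x y' x' /= e; exists (y'^-1 * y)%g; split; first by rewrite mulKVg.
    by apply: (mulgI y'); rewrite mulgA mulKVg.
  - by move=> z; exists (1%g, z); rewrite /= mul1g.
  - by move=> c y x /=; rewrite mulgA.
  - by move=> y x c /=; rewrite mulgA.
apply: biset_iso_sym.
apply: (@bcomp_isoP _ _ _ (Ind p) (Res q) Z (fun y x => f y * g x)%g).
- by move=> y c x /=; rewrite !gmulfM comm mulgA.
- move=> y x y' x' /= e.
  (* The equation [e] amounts to [f (y'^-1 * y) = g (x' * x^-1)]. *)
  have [|c [yE xE]] := pull (y'^-1 * y)%g (x' * x^-1)%g.
    apply: (mulgI (f y')); apply: (mulIg (g x)).
    by rewrite -gmulfM mulKVg e -mulgA -gmulfM mulgKV.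
  by exists c; rewrite -yE -xE mulKVg mulgKV.
- by move=> z; have [x <-] := fsurj z; exists (x, 1%g); rewrite /= mult1 mulg1.
- by move=> c y x /=; rewrite gmulfM mulgA.
- by move=> y x c /=; rewrite gmulfM mulgA.
Qed.

(** * Product homomorphisms and the two arrow bisets *)

Section ProductMorphism.
Variables (G G' H H' : finGroupType).
Variables (f : {multiplicative G -> G'}) (g : {multiplicative H -> H'}).

Definition prod_map (x : (G * H)%type) : (G' * H')%type := (f x.1, g x.2).

Fact prod_mapM : {morph prod_map : x y / (x * y)%g}.
Proof. by move=> x y; rewrite /prod_map /= !gmulfM. Qed.

HB.instance Definition _ :=
  isMultiplicative.Build (G * H)%type (G' * H')%type prod_map prod_mapM.

End ProductMorphism.

(** Tensoring with a point over [G] leaves the cosets of the diagonal in [G * G], which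
    [(a, b) |-> a * b^-1] identifies with [G]. *)
Lemma rarrow_iso (G : finGroupType) (t : {multiplicative G -> grp1}) :
  biset_iso (bcomp (Ind (@diag G)) (Res t)) (rarrow G).
Proof.
apply: (@bcomp_isoP _ _ _ (Ind (@diag G)) (Res t) (rarrow G)
  (fun y _ => y.1 * y.2^-1)%g).
- by move=> y c x /=; rewrite invMg mulgA mulgK.
(* By [e], [a'^-1 * a = b'^-1 * b], so one diagonal element carries [(a', b')] to [(a, b)]. *)
- case=> [a b] x [a' b'] x' /= e; exists (a'^-1 * a)%g.
  split; last by rewrite [LHS]ord1 [RHS]ord1.
  have -> : a = (a' * b'^-1 * b)%g by rewrite -e mulgKV.
  by rewrite /diag /= -!mulgA mulKg; congr (_, _); rewrite /= mulKVg.
- by move=> z; exists ((z, 1%g), ord0); rewrite /= invg1 mulg1.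
- by move=> c y x /=; rewrite invMg !mulgA.
- by [].
Qed.

(** Composing [larrow] with the induction restricts its right action along [Delta x Delta], which
    gives [Z]. In the other composite, the three coordinates of the map to [Z] are a complete set of
    invariants of a class. *)
Lemma larrow_diag_iso (G : finGroupType) :
  biset_iso (bcomp (larrow G G G) (Ind (prod_map (@diag G) (@diag G))))
            (bcomp (Ind (@diag G)) (Res (@diag G))).
Proof.
pose dd : {multiplicative (G * G)%type -> ((G * G) * (G * G))%type} :=
  prod_map (@diag G) (@diag G).
pose ra (t : larrow G G G) (c : (G * G)%type) := ract (larrow G G G) t (dd c).
have ra1 t : ra t 1%g = t by rewrite /ra mult1 ract1.
have raM t c d : ra t (c * d)%g = ra (ra t c) d by rewrite /ra gmulfM ractM.
have lra c t d : ra (lact (larrow G G G) c t) d = lact (larrow G G G) c (ra t d).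
  exact: lractA.
pose Z := @Biset (G * G)%type (G * G)%type (larrow G G G) (lact (larrow G G G)) ra
  (@lact1 _ _ _) (@lactM _ _ _) ra1 raM lra.
apply: (@biset_iso_trans _ _ _ Z).
  apply: (@bcomp_isoP _ _ _ (larrow G G G) (Ind dd) Z
    (fun y x => ract (larrow G G G) y x)).
  - by move=> y c x; rewrite -ractM.
  - move=> y x y' x' e; exists (x' * x^-1)%g; split; last by rewrite /= mulgKV.
    by rewrite ractM -e -ractM mulgV ract1.
  - by move=> z; exists (z, 1%g); apply: ract1.
  - by move=> c y x; rewrite lractA.
  - by move=> y x c; exact: (@ractM _ _ (larrow G G G) y x (dd c)).
apply: biset_iso_sym.
apply: (@bcomp_isoP _ _ _ (Ind (@diag G)) (Res (@diag G)) Z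
  (fun y x => (y.1 * x.1, x.1^-1 * x.2, y.2 * x.2)%g)).
- by move=> y c x /=; rewrite invMg !mulgA mulgKV.
(* By [e2], [u' * u^-1 = v' * v^-1], so the same element serves both coordinates. *)
- case=> [a b] [u v] [a' b'] [u' v'] /= [e1 e2 e3]; exists (u' * u^-1)%g.
  rewrite /diag; split; congr (_, _) => /=.
  + by apply: (mulIg u); rewrite -mulgA mulgKV.
  + apply: (mulIg v); rewrite -!mulgA e2 e3 mulKVg //.
  + by rewrite mulgKV.
  + by rewrite -mulgA e2 mulKVg.
(* Normalising [x.1] to 1 forces the other three entries. *)
- case=> [[a h] b]; exists ((a, (b * h^-1)%g), (1%g, h)) => /=.
  by rewrite mulg1 invg1 mul1g mulgKV.
- by move=> c y x /=; rewrite !mulgA.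
- by move=> y x c; rewrite /= /ra /= invMg !mulgA.
Qed.

(** * Cross products and composition in a Green biset functor *)

Section GreenFunctor.
Variables (k : comPzRingType) (D : biset_subcat) (A : green_functor k D).

Lemma gbis_iso (G H : dobj D) (X Y : biset H G) (a : A G) :
  biset_iso X Y -> gbis A G H X a = gbis A G H Y a.
Proof. by move=> XY; rewrite /gbis (bclass_iso _ XY). Qed.

Lemma gbis_comp (G H K : dobj D) (Y : biset K H) (X : biset H G) (a : A G) :
  gbis A H K Y (gbis A G H X a) = gbis A G K (bcomp Y X) a.
Proof.
by rewrite /gbis -bdot_class; case: (gact_functor A) => _ _ ->.
Qed.

Lemma gbis_reg (G : dobj D) (a : A G) : gbis A G G (breg G) a = a.
Proof. by case: (gact_functor A) => _ gid _; apply: gid. Qed.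

Lemma gbis_Ind_comp (G H K : dobj D) (f : {multiplicative G -> H})
    (g : {multiplicative H -> K}) (h : {multiplicative G -> K}) (a : A G) :
  (forall x, h x = g (f x)) ->
  gbis A H K (Ind g) (gbis A G H (Ind f) a) = gbis A G K (Ind h) a.
Proof. by move=> hE; rewrite gbis_comp (gbis_iso _ (Ind_comp hE)). Qed.

Lemma gbis_Res_comp (G H K : dobj D) (f : {multiplicative G -> H})
    (g : {multiplicative H -> K}) (h : {multiplicative G -> K}) (a : A K) :
  (forall x, h x = g (f x)) ->
  gbis A H G (Res f) (gbis A K H (Res g) a) = gbis A K G (Res h) a.
Proof. by move=> hE; rewrite gbis_comp (gbis_iso _ (Res_comp hE)). Qed.

Lemma gbis_Res_Ind (P K G H : dobj D) (p : {multiplicative P -> K})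
    (q : {multiplicative P -> G}) (f : {multiplicative K -> H})
    (g : {multiplicative G -> H}) (a : A G) :
  (forall c, f (p c) = g (q c)) ->
  (forall x y, f x = g y -> exists c, x = p c /\ y = q c) ->
  (forall z, exists x, f x = z) ->
  gbis A H K (Res f) (gbis A G H (Ind g) a) =
  gbis A P K (Ind p) (gbis A G P (Res q) a).
Proof.
move=> comm pull fsurj.
by rewrite !gbis_comp (gbis_iso _ (Res_Ind_pullback comm pull fsurj)).
Qed.

Lemma gbis_frobl (G H : dobj D) (f : {multiplicative G -> H}) (a : A H) (b : A G) :
  a * gbis A G H (Ind f) b = gbis A G H (Ind f) (gbis A H G (Res f) a * b).
Proof. exact: gact_frobl. Qed.

Lemma gbis_frobr (G H : dobj D) (f : {multiplicative G -> H}) (a : A H) (b : A G) :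
  gbis A G H (Ind f) b * a = gbis A G H (Ind f) (b * gbis A H G (Res f) a).
Proof. exact: gact_frobr. Qed.

Lemma gbis_ResM (G H : dobj D) (f : {multiplicative G -> H}) (a b : A H) :
  gbis A H G (Res f) (a * b) = gbis A H G (Res f) a * gbis A H G (Res f) b.
Proof. exact: gact_resM. Qed.

(** One factor is induced at a time, [prod_map f g] being [f1] after [g1]: a pullback square
    exchanges inflation and induction, then Frobenius reciprocity takes the induction out of the
    product. *)
Lemma gcross_Ind (G G' H H' : dobj D) (f : {multiplicative G -> G'})
    (g : {multiplicative H -> H'}) (a : A G) (b : A H) :
  gcross (gbis A G G' (Ind f) a) (gbis A H H' (Ind g) b) =
  gbis A (dobj_prod G H) (dobj_prod G' H') (Ind (prod_map f g)) (gcross a b).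
Proof.
pose f1 : {multiplicative (G * H')%type -> (G' * H')%type} := prod_map f idfun.
pose g1 : {multiplicative (G * H)%type -> (G * H')%type} := prod_map idfun g.
rewrite /gcross (@gbis_Res_Ind (dobj_prod G H') (dobj_prod G' H') G G' f1 fst fst f) //;
  first last.
- by move=> z; exists (z, 1%g).
- by move=> [x1 x2] y /= ->; exists (y, x2).
rewrite (@gbis_frobr (dobj_prod G H') (dobj_prod G' H')).
(* As [f1] fixes the second coordinate, the other factor is still an inflation. *)
rewrite (@gbis_Res_comp (dobj_prod G H') (dobj_prod G' H') H' f1 snd snd) //.
rewrite (@gbis_Res_Ind (dobj_prod G H) (dobj_prod G H') H H' g1 snd snd g) //;
  first last.
- by move=> z; exists (1%g, z).
- by move=> [x1 x2] y /= ->; exists (x1, y).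
rewrite (@gbis_frobl (dobj_prod G H) (dobj_prod G H')).
rewrite (@gbis_Res_comp (dobj_prod G H) (dobj_prod G H') G g1 fst fst) //.
exact: (@gbis_Ind_comp (dobj_prod G H) (dobj_prod G H') (dobj_prod G' H')).
Qed.

(** Restriction along [diag] is multiplicative and undoes both inflations, since each projection
    after [diag] is the identity. *)
Lemma Res_diag_gcross (G : dobj D) (a b : A G) :
  gbis A (dobj_prod G G) G (Res (@diag G)) (gcross a b) = a * b.
Proof.
rewrite (@gbis_ResM G (dobj_prod G G)).
rewrite !(@gbis_Res_comp G (dobj_prod G G) G (@diag G) _ idfun) //.
by rewrite !(gbis_iso _ (@Res_id _ idfun _)) // !gbis_reg.
Qed.

Lemma Pcomp_gtilde (G : dobj D) (a b : A G) :
  Pcomp (gtilde a) (gtilde b) = gtilde (a * b).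
Proof.
rewrite /Pcomp /gtilde (@gcross_Ind G (dobj_prod G G) G (dobj_prod G G)).
rewrite (@gbis_comp (dobj_prod G G) (dobj_prod (dobj_prod G G) (dobj_prod G G))
  (dobj_prod G G)).
rewrite (@gbis_iso (dobj_prod G G) (dobj_prod G G) _ _ _ (larrow_diag_iso G)).
by rewrite -(@gbis_comp (dobj_prod G G) G (dobj_prod G G)) Res_diag_gcross.
Qed.

(** By [rarrow_iso], the identity arrow is induced along [diag] from the restriction of [geps] along
    [G -> 1], and restriction preserves 1. *)
Lemma gtilde1 (G : dobj D) : gtilde (1 : A G) = Pid A G.
Proof.
pose t : G -> grp1 := fun=> 1%g.
have tM : {morph t : x y / (x * y)%g} by move=> x y; rewrite mulg1.
pose tm : {multiplicative G -> grp1} :=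
  HB.pack t (isMultiplicative.Build G grp1 t tM).
rewrite /Pid /geps -(@gbis_iso (dobj1 D) (dobj_prod G G) _ _ _ (rarrow_iso tm)).
rewrite -(@gbis_comp (dobj1 D) G (dobj_prod G G)) /gtilde; congr gbis.
exact: esym (@gact_res1 _ _ A G (dobj1 D) tm).
Qed.

Lemma gtilde_inj (G : dobj D) : injective (@gtilde k D A G).
Proof.
apply: (can_inj (g := gbis A (dobj_prod G G) G (Ind fst))) => a.
rewrite /gtilde (@gbis_Ind_comp G (dobj_prod G G) G (@diag G) fst idfun) //.
by rewrite (gbis_iso _ (@Ind_id _ idfun _)) // gbis_reg.
Qed.

End GreenFunctor.

(** * Inverses, duality and orthogonality *)

Section StarGreenFunctor.
Variables (k : comPzRingType) (D : biset_subcat) (A : star_green_functor k D).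

(** Inverses are preserved because [gtilde] is multiplicative and unital, and reflected because it
    is injective. The order of [u] and [v] follows that of the two equations in [Pinverse]. *)
Lemma Pinverse_gtilde (G : dobj D) (u v : A G) :
  Pinverse (gtilde u) (gtilde v) <-> inverses v u.
Proof.
rewrite /Pinverse /inverses !Pcomp_gtilde -gtilde1.
by split=> -[]; [move=> /gtilde_inj ? /gtilde_inj ? | move=> -> ->].
Qed.

Lemma bullet_gtilde (G : dobj D) (u : A G) : bullet (gtilde u) = gtilde (star A u).
Proof.
rewrite /bullet {1}/gtilde {2}/gbis star_natural.
exact: (@gbis_Ind_comp _ _ _ G (dobj_prod G G) (dobj_prod G G)).
Qed.

End StarGreenFunctor.

Theorem proposition5p4 (k : comPzRingType) (D : biset_subcat)
    (A : star_green_functor k D) (G : dobj D) :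
  [/\ forall u : A G, orthogonal_unit u -> orthogonal_aut (gtilde u),
      gtilde (1 : A G) = Pid A G,
      forall u v : A G, orthogonal_unit u -> orthogonal_unit v ->
        gtilde (u * v) = Pcomp (gtilde u) (gtilde v)
    & forall u v : A G, orthogonal_unit u -> orthogonal_unit v ->
        gtilde u = gtilde v -> u = v] /\
  (forall u : A G, is_unit u -> orthogonal_aut (gtilde u) -> orthogonal_unit u).
Proof.
split; first split.
- move=> u [v [uv vu] uE]; rewrite -uE in uv vu.
  exists (gtilde (star A u)); last exact: bullet_gtilde.
  exact/Pinverse_gtilde.
- exact: gtilde1.
- by move=> u v _ _; rewrite Pcomp_gtilde.
- by move=> u v _ _; apply: gtilde_inj.
(* The inverse of [gtilde u] is its dual [gtilde (star A u)]; reflecting inverses makes [star A u]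
   the inverse of [u]. *)
- move=> u _ [w uw wE]; move: uw; rewrite -wE bullet_gtilde.
  by move/Pinverse_gtilde => -[vu uv]; exists (star A u).
Qed.
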